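(* Let $(X,\mathrm d,\mathfrak m)$ be a $\mathrm{CD}(0,\infty)$ metric measure space. Then its volume entropy exists in $[0,+\infty]$; that is, there is $x_0\in X$ such that the limit $$h_{(X,\mathrm d,\mathfrak m)}:=\lim_{r\to+\infty}\frac{\ln\mathfrak m\big(B_r(x_0)\big)}{r}\in[0,+\infty]$$ exists.
   Context: A metric measure space $(X,\mathrm d,\mathfrak m)$ is a complete separable metric space $(X,\mathrm d)$ with a locally finite, non-negative Radon measure $\mathfrak m$ of full support. $B_r(x_0)=\{x\in X:\mathrm d(x,x_0)<r\}$. $\mathrm{CD}(0,\infty)$ condition (Lott–Sturm–Villani): let $\mathrm{Ent}_{\mathfrak m}(\mu)=\int\ln\rho\,\mathrm d\mu$ if $\mu=\rho\,\mathfrak m$ and $+\infty$ otherwise. The space satisfies $\mathrm{CD}(0,\infty)$ if for any $\mu_0,\mu_1$ in the $L^2$-Wasserstein space $(\mathcal P_2(X),W_2)$ there is a $W_2$-geodesic $(\mu_t)_{t\in[0,1]}$ from $\mu_0$ to $\mu_1$ with $\mathrm{Ent}_{\mathfrak m}(\mu_t)\le t\,\mathrm{Ent}_{\mathfrak m}(\mu_1)+(1-t)\,\mathrm{Ent}_{\mathfrak m}(\mu_0)$ for all $t\in[0,1]$. *)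

(* Defs.v *)
From HB Require Import structures.
From mathcomp Require Import all_boot all_order all_algebra.
From mathcomp Require Import all_classical all_reals all_analysis.

Set Implicit Arguments.
Unset Strict Implicit.
Unset Printing Implicit Defensive.
Import Order.TTheory GRing.Theory Num.Theory.
Import numFieldNormedType.Exports.

Local Open Scope classical_set_scope.
Local Open Scope ring_scope.
Local Open Scope ereal_scope.

(* As with the library's complete pseudometric spaces, the structure is
   pointed: metric spaces are nonempty. *)
#[short(type="completeMetricType")]
HB.structure Definition CompleteMetric (K : numDomainType) :=
  {T of CompletePseudoMetric K T & Metric K T}.

Notation borel X := (g_sigma_algebraType (@open X)).

Definition separable (T : topologicalType) :=
  exists2 S : set T, countable S & dense S.

Section metric_measure_space.
Context {R : realType} {X : completeMetricType R}.
Implicit Type m : {measure set (borel X) -> \bar R}.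

Definition locally_finite m :=
  forall x : X, exists2 U : set X, open_nbhs x U & m U < +oo.

Definition inner_regular m :=
  forall A : set (borel X), measurable A ->
    m A = ereal_sup [set m K | K in [set K : set X | compact K /\ K `<=` A]].

Definition radon m := locally_finite m /\ inner_regular m.

Definition msupport m : set X :=
  [set x | forall U : set X, open_nbhs x U -> 0 < m U].

Definition metric_measure_space m :=
  [/\ separable X, radon m & msupport m = setT].

End metric_measure_space.

Section wasserstein.
Context {R : realType} {X : completeMetricType R}.
Implicit Types mu nu : probability (borel X) R.

(* A library measure takes arbitrary values off the measurable sets, hence
   measures are only compared on measurable sets. *)
Definition same_measure mu nu :=
  forall A : set (borel X), measurable A -> mu A = nu A.

Definition P2 mu :=
  exists x0 : X, \int[mu]_x ((@mdist R X x x0) ^+ 2)%:E < +oo.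

(* For separable X the product sigma-algebra on X * X is the Borel one. *)
Definition coupling mu nu : set (probability (borel X * borel X)%type R) :=
  [set gamma | forall A : set (borel X), measurable A ->
     gamma (A `*` setT) = mu A /\ gamma (setT `*` A) = nu A].

Definition W2 mu nu : \bar R :=
  sqrte (ereal_inf [set \int[gamma]_z ((@mdist R X z.1 z.2) ^+ 2)%:E
                   | gamma in coupling mu nu]).

Definition W2_geodesic (mu_ : R -> probability (borel X) R) mu0 mu1 :=
  [/\ forall t : R, (0 <= t <= 1)%R -> P2 (mu_ t),
      same_measure (mu_ 0%R) mu0, same_measure (mu_ 1%R) mu1 &
      forall s t : R, (0 <= s <= 1)%R -> (0 <= t <= 1)%R ->
        W2 (mu_ s) (mu_ t) = `|t - s|%R%:E * W2 mu0 mu1].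

End wasserstein.

Section curvature_dimension.
Context {R : realType} {X : completeMetricType R}.
Variable m : {measure set (borel X) -> \bar R}.
Implicit Type mu : probability (borel X) R.

Definition is_density mu (rho : borel X -> R) :=
  [/\ measurable_fun setT rho, forall x, (0 <= rho x)%R &
      forall A : set (borel X), measurable A ->
        mu A = \int[m]_(x in A) (rho x)%:E].

(* Densities are m-a.e. unique, so the choice of rho is irrelevant, and so is
   the value ln 0 = 0 since [set x | rho x = 0] is mu-negligible. The inner test
   is the usual convention that the entropy is +oo as soon as the positive part
   of ln rho is not mu-integrable; the library's integral would be -oo when the
   negative part is not integrable either. *)
Definition Ent mu : \bar R :=
  match pselect (exists rho, is_density mu rho) with
  | left mu_m =>
      let lnrho := fun x => (ln (sval (cid mu_m) x))%:E in
      if \int[mu]_x (lnrho^\+ x) == +oo then +oo else \int[mu]_x lnrho x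
  | right _ => +oo
  end.

(* In the dual scope +oo absorbs -oo in sums: the inequality is void (for
   0 < t < 1) as soon as one end point has infinite entropy. *)
Definition CD0oo :=
  forall mu0 mu1, P2 mu0 -> P2 mu1 ->
    exists2 mu_ : R -> probability (borel X) R, W2_geodesic mu_ mu0 mu1 &
      forall t : R, (0 <= t <= 1)%R ->
        (Ent (mu_ t) <= t%:E * Ent mu1 + (1 - t)%R%:E * Ent mu0)%dE.

End curvature_dimension.

(* Main.v *)
Require Import Defs.
From HB Require Import structures.
From mathcomp Require Import all_boot all_order all_algebra.
From mathcomp Require Import all_classical all_reals all_analysis.
From mathcomp Require Import measurable_realfun ring lra.

Set Implicit Arguments.
Unset Strict Implicit.
Unset Printing Implicit Defensive.
Import Order.TTheory GRing.Theory Num.Theory.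
Import numFieldNormedType.Exports.

Local Open Scope classical_set_scope.
Local Open Scope ring_scope.
Local Open Scope ereal_scope.

(* Fix x0 and put f r := ln (m (ball x0 r)).  If some ball has infinite measure,
   the limit is +oo.  Otherwise, a geodesic between the uniform measures on
   ball x0 1 and ball x0 r along which the entropy is convex gives, at time t,
   a measure concentrated on ball x0 s as soon as s > 1 + t (1 + r); Jensen's
   inequality then yields the Brunn-Minkowski type bound
     (1 - t) f 1 + t f r <= f s.
   With t = (s - 3) / r it says that (f r - f 1) / r <= (f s - f 1) / (s - 3)
   whenever s - 3 < r, whence f r / r tends to the infimum of the right-hand
   sides.

   The concentration statement needs neither optimal plans nor disintegration.
   Take almost optimal plans from mu0 to mu_t and from mu_t to mu1, and glue
   them approximately, along a partition of X into small cells with centres z_n.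
   Writing a, b, c for the distances x z_n, x y, z_n y,
     t (1 - t) b^2 + (a - t b)^2 <= (1 - t) a^2 + t c^2,
   and the integrals of the outer terms agree up to a small error, so that
   a <= t b up to a small error with probability close to 1. *)

(** * Measurability of the distance and fine partitions of a separable metric space *)

Section separable_metric.
Context {R : realType} {X : completeMetricType R}.
Local Notation dist := (@mdist R X).

Lemma measurable_mdistl (y : X) :
  measurable_fun setT (fun x : borel X => dist x y : R).
Proof.
apply: (measurability _ (RGenOInfty.measurableE R)) => _ [_ [c ->] <-].
rewrite setTI; apply: sub_sigma_algebra => /=.
rewrite openE => x /=; rewrite in_itv/= andbT => cx.
apply/nbhs_ballP; exists (dist x y - c)%R; first by rewrite /= subr_gt0.
move=> z; rewrite ballEmdist /= in_itv/= andbT => xz.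
have := metric_triangle x z y; lra.
Qed.

Lemma measurable_borel_ball (x : X) (r : R) : measurable (ball x r : set (borel X)).
Proof.
rewrite ballEmdist (_ : mkset _ = (fun y => dist y x) @^-1` `]-oo, r[).
  by rewrite -[X in measurable X]setTI; exact: measurable_mdistl.
by apply/seteqP; split => y /=; rewrite in_itv/= metric_sym.
Qed.

Lemma dense_sequence : separable X ->
  exists s : nat -> X, forall x (e : R), (0 < e)%R -> exists n, (dist x (s n) < e)%R.
Proof.
move=> [S cS dS].
have [x0 Sx0] : S !=set0.
  by have [|x []] := dS setT _ openT; [exists point|exists x].
have /pfcard_geP[S0|[f]] := cS; first by rewrite S0 in Sx0.
exists f => x e e0.
have [||y [yB Sy]] := dS (interior (ball x e)).
- by exists x; apply/nbhs_ballP; exists e.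
- exact: open_interior.
have [n _ fn] := @surj _ _ _ _ f y Sy.
by exists n; rewrite fn; move: (interior_subset yB); rewrite ballEmdist.
Qed.

(** The sublevel sets have to lie in the product sigma-algebra. By density, [dist z.1 z.2 < c] holds
    iff [dist z.1 (s n) + dist z.2 (s n) < c] for some [n], and each such sum treats the two
    coordinates separately. *)
Lemma measurable_mdist : separable X ->
  measurable_fun setT (fun z : borel X * borel X => dist z.1 z.2 : R).
Proof.
move=> /dense_sequence[s sP].
apply: (measurability _ (RGenInftyO.measurableE R)) => _ [_ [c ->] <-].
rewrite setTI.
pose g n (z : borel X * borel X) := (dist z.1 (s n) + dist z.2 (s n))%R.
have mg n : measurable_fun setT (g n).
  by apply: measurable_funD; apply: (measurableT_comp (measurable_mdistl _)).
rewrite (_ : _ @^-1` _ = \bigcup_n (g n @^-1` `]-oo, c[)).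
  by apply: bigcup_measurable => n _; rewrite -[X in measurable X]setTI; exact: mg.
apply/seteqP; split => [z|z [n _]] /=; rewrite !in_itv/=.
  move=> zc; have [|n zn] := sP z.2 ((c - dist z.1 z.2) / 2)%R; first lra.
  exists n => //=; rewrite in_itv/= /g.
  have := metric_triangle z.1 z.2 (s n); lra.
rewrite /g; have := metric_triangle z.1 (s n) z.2.
by rewrite (metric_sym (s n)); exact: le_lt_trans.
Qed.

(** The balls of radius [e] around a dense sequence cover the space; removing from each ball the
    earlier ones makes them disjoint. *)
Lemma small_partition (e : R) : separable X -> (0 < e)%R ->
  exists (A : nat -> set (borel X)) (s : nat -> X),
  [/\ forall n, measurable (A n), trivIset setT A, \bigcup_n A n = setT &
      forall n x, A n x -> (dist x (s n) < e)%R].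
Proof.
move=> /dense_sequence[s sP] e0.
exists (seqDU (fun n => ball (s n) e)), s; split.
- move=> n; rewrite /seqDU; apply: measurableD; first exact: measurable_borel_ball.
  by apply: bigsetU_measurable => i _; exact: measurable_borel_ball.
- exact: trivIset_seqDU.
- rewrite -seqDU_bigcup_eq -subTset => x _; have [n xn] := sP x _ e0.
  by exists n => //; rewrite ballEmdist /= metric_sym.
- by move=> n x [+ _]; rewrite ballEmdist /= metric_sym.
Qed.

End separable_metric.

(** * Conditional laws given an event *)

Section conditioning.
Context d d' (T : measurableType d) (T' : measurableType d') (R : realType).

Lemma ge0_integral_mrestr (mu : {measure set T -> \bar R}) (A : set T)
    (mA : measurable A) (f : T -> \bar R) :
  measurable_fun setT f -> (forall x, 0 <= f x) ->
  \int[mrestr mu mA]_x f x = \int[mu]_(x in A) f x.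
Proof.
move=> mf f0; rewrite (@ge0_negligible_integral _ _ _ _ setT (~` A))//.
- rewrite setTD setCK; apply: eq_measure_integral => B mB BA.
  by rewrite /= /mrestr setIidl.
- exact: measurableC.
- by rewrite /= /mrestr setICl measure0.
Qed.

(** [Q] is the law of [f] under [P] conditioned on [A]. There is no division by [P A]: on a null
    event the normalisation falls back on [P] and both sides vanish. *)
Lemma conditional_distribution (P : probability T R) (f : T -> T')
    (A : set T) : measurable_fun setT f -> measurable A -> exists Q : probability T' R,
  forall g : T' -> \bar R, measurable_fun setT g -> (forall y, 0 <= g y) ->
    \int[P]_(x in A) g (f x) = P A * \int[Q]_y g y.
Proof.
move=> mf mA; pose f_ := isMeasurableFun.Build _ _ _ _ f mf.
pose F : {mfun T >-> T'} := HB.pack f f_.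
pose C := mnormalize (mrestr P mA) P.
have PAfin : P A \is a fin_num by rewrite fin_num_measure.
have PA0 : (0 <= fine (P A))%R by rewrite fine_ge0.
have CE B : measurable B -> P (B `&` A) = P A * C B.
  move=> mB; rewrite /C /mnormalize /= /mrestr setTI.
  have [PA|nPA] /= := eqVneq (P A) 0.
    rewrite PA mul0e; apply: (subset_measure0 (T := T)) PA => //.
    exact: measurableI.
  have -> /= : (P A == +oo) = false by apply/negP => /eqP PAy; rewrite PAy in PAfin.
  rewrite muleCA; move: PAfin nPA; case: (P A) => // r _ r0.
  by rewrite -EFinM divff ?mule1.
exists (distribution C F) => g mg g0.
have mgf : measurable_fun setT (g \o f) by exact: measurableT_comp.
rewrite ge0_integral_distribution// -(ge0_integral_mrestr _ mA)//.
(* The factor [P A] is absorbed into the measure, which reduces the claim to an equality of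
   measures. *)
rewrite -(fineK PAfin) -(ge0_integral_mscale _ _ (NngNum PA0))//; last first.
  by move=> x _; exact: g0.
apply: eq_measure_integral => B mB _ /=.
by rewrite /mscale /mrestr/= fineK// CE.
Qed.

End conditioning.

(** * Gluing two plans along a countable partition *)

Section gluing.
Context d1 d2 d3 (T1 : measurableType d1) (T2 : measurableType d2)
  (T3 : measurableType d3) (R : realType).

Lemma integral_product_fst (P : probability T1 R) (Q : probability T3 R)
    (f : T1 -> \bar R) : measurable_fun setT f -> (forall x, 0 <= f x) ->
  \int[P \x Q]_z f z.1 = \int[P]_x f x.
Proof.
move=> mf f0; rewrite fubini_tonelli1//=; last exact: measurableT_comp.
apply: eq_integral => x _; rewrite /fubini_F/= integral_cst//.
by rewrite [X in _ * X](@probability_setT _ _ _ Q) mule1.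
Qed.

Lemma integral_product_snd (P : probability T1 R) (Q : probability T3 R)
    (f : T3 -> \bar R) : measurable_fun setT f -> (forall x, 0 <= f x) ->
  \int[P \x Q]_z f z.2 = \int[Q]_y f y.
Proof.
move=> mf f0; rewrite fubini_tonelli2//=; last exact: measurableT_comp.
apply: eq_integral => y _; rewrite /fubini_G/= integral_cst//.
by rewrite [X in _ * X](@probability_setT _ _ _ P) mule1.
Qed.

Lemma ge0_integral_partition (d : measure_display) (T : measurableType d)
    (mu : {measure set T -> \bar R}) (A : nat -> set T) (f : T -> \bar R) :
  (forall n, measurable (A n)) -> trivIset setT A -> \bigcup_n A n = setT ->
  measurable_fun setT f -> (forall x, 0 <= f x) ->
  \int[mu]_x f x = \sum_(n <oo) \int[mu]_(x in A n) f x.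
Proof. by move=> mA tA UA mf f0; rewrite -UA ge0_integral_bigcup// UA. Qed.

(* Gluing along the middle factor without disintegration: condition on the cells
   of a countable partition and couple the two outer coordinates independently
   in each cell. *)
Lemma gluing (g1 : probability (T1 * T2)%type R)
    (g2 : probability (T2 * T3)%type R) (A : nat -> set T2) :
  (forall n, measurable (A n)) -> trivIset setT A -> \bigcup_n A n = setT ->
  (forall B, measurable B -> g1 (setT `*` B) = g2 (B `*` setT)) ->
  exists (P : nat -> probability T1 R) (Q : nat -> probability T3 R)
    (s : probability (T1 * T3)%type R),
  [/\ forall n (f : T1 -> \bar R), measurable_fun setT f ->
        (forall x, 0 <= f x) -> \int[g1]_(z in setT `*` A n) f z.1 =
        g1 (setT `*` A n) * \int[P n]_x f x,
      forall n (f : T3 -> \bar R), measurable_fun setT f ->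
        (forall x, 0 <= f x) -> \int[g2]_(z in A n `*` setT) f z.2 =
        g1 (setT `*` A n) * \int[Q n]_x f x,
      forall f : T1 * T3 -> \bar R, measurable_fun setT f ->
        (forall x, 0 <= f x) -> \int[s]_z f z =
        \sum_(n <oo) g1 (setT `*` A n) * \int[P n \x Q n]_z f z,
      forall B, measurable B -> s (B `*` setT) = g1 (B `*` setT) &
      forall B, measurable B -> s (setT `*` B) = g2 (setT `*` B)].
Proof.
move=> mA tA UA g12.
have m1A n : measurable (setT `*` A n : set (T1 * T2)) by exact: measurableX.
have m2A n : measurable (A n `*` setT : set (T2 * T3)) by exact: measurableX.
have t1A : trivIset setT (fun n => setT `*` A n : set (T1 * T2)).
  by apply/trivIsetP => i j _ _ ij; rewrite -setXI (iffLR trivIsetP tA)// setX0.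
have t2A : trivIset setT (fun n => A n `*` setT : set (T2 * T3)).
  by apply/trivIsetP => i j _ _ ij; rewrite -setXI (iffLR trivIsetP tA)// set0X.
have U1A : \bigcup_n (setT `*` A n : set (T1 * T2)) = setT.
  rewrite -subTset => z _; have [n _ Az] : (\bigcup_n A n) z.2 by rewrite UA.
  by exists n.
have U2A : \bigcup_n (A n `*` setT : set (T2 * T3)) = setT.
  rewrite -subTset => z _; have [n _ Az] : (\bigcup_n A n) z.1 by rewrite UA.
  by exists n.
have /choice[P PE] n : exists P : probability T1 R, forall f : T1 -> \bar R,
    measurable_fun setT f -> (forall x, 0 <= f x) ->
    \int[g1]_(z in setT `*` A n) f z.1 = g1 (setT `*` A n) * \int[P]_x f x.
  exact: (conditional_distribution g1 measurable_fst (m1A n)).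
have /choice[Q QE] n : exists Q : probability T3 R, forall f : T3 -> \bar R,
    measurable_fun setT f -> (forall x, 0 <= f x) ->
    \int[g2]_(z in A n `*` setT) f z.2 = g1 (setT `*` A n) * \int[Q]_x f x.
  by rewrite g12//; exact: (conditional_distribution g2 measurable_snd (m2A n)).
pose w n := fine (g1 (setT `*` A n)).
have w0 n : (0 <= w n)%R by rewrite fine_ge0.
have wE n : (w n)%:E = g1 (setT `*` A n) by rewrite fineK// fin_num_measure.
(* The glued measure is the mixture of the products [P n \x Q n], weighted by the masses of the
   cells. *)
have [s0 s0E] : exists s0 : {measure set (T1 * T3)%type -> \bar R},
    forall f : T1 * T3 -> \bar R, measurable_fun setT f ->
    (forall x, 0 <= f x) -> \int[s0]_z f z =
    \sum_(n <oo) g1 (setT `*` A n) * \int[P n \x Q n]_z f z.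
  exists (mseries (fun n => mscale (NngNum (w0 n)) (P n \x Q n)) 0) => f mf f0.
  rewrite ge0_integral_measure_series//.
  by apply: eq_eseriesr => n _; rewrite ge0_integral_mscale//= wE.
have mind d (T : measurableType d) (B : set T) : measurable B ->
    measurable_fun setT (EFin \o (\1_B : T -> R)).
  by move=> mB; apply/measurable_EFinP; exact: measurable_indic.
have ind0 d (T : measurableType d) (B : set T) x :
    0 <= (EFin \o (\1_B : T -> R)) x by rewrite lee_fin.
have indE d (T : measurableType d) (mu : {measure set T -> \bar R}) B :
    measurable B -> mu B = \int[mu]_x (\1_B x)%:E.
  by move=> mB; rewrite integral_indic// setIT.
(* Each product has first marginal [P n], and summing over the cells reassembles the first marginal
   of [g1]. The second marginal is recovered from [g2] in the same way. *)
have s01 B : measurable B -> s0 (B `*` setT) = g1 (B `*` setT).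
  move=> mB; have mX d (T : measurableType d) :
      measurable (B `*` setT : set (T1 * T)) by exact: measurableX.
  transitivity (\int[s0]_z (EFin \o (\1_B : T1 -> R)) z.1).
    rewrite [LHS]indE; last exact: mX.
    apply: eq_integral => z _.
    by rewrite /= !indicE in_setX in_setT andbT.
  rewrite s0E//; last first.
    by apply: measurableT_comp => //; exact: mind.
  transitivity (\int[g1]_z (EFin \o (\1_B : T1 -> R)) z.1).
    rewrite (@ge0_integral_partition _ _ _ (fun n => setT `*` A n))//; last first.
      by apply: measurableT_comp => //; exact: mind.
    apply: eq_eseriesr => n _; rewrite (PE n _ (mind _ _ _ mB) (ind0 _ _ _)).
    by rewrite (integral_product_fst _ _ (mind _ _ _ mB) (ind0 _ _ _)).
  rewrite [RHS]indE; last exact: mX.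
  by apply: eq_integral => z _; rewrite /= !indicE in_setX in_setT andbT.
have s02 B : measurable B -> s0 (setT `*` B) = g2 (setT `*` B).
  move=> mB; have mX d (T : measurableType d) :
      measurable (setT `*` B : set (T * T3)) by exact: measurableX.
  transitivity (\int[s0]_z (EFin \o (\1_B : T3 -> R)) z.2).
    rewrite [LHS]indE; last exact: mX.
    apply: eq_integral => z _.
    by rewrite /= !indicE in_setX in_setT.
  rewrite s0E//; last first.
    by apply: measurableT_comp => //; exact: mind.
  transitivity (\int[g2]_z (EFin \o (\1_B : T3 -> R)) z.2).
    rewrite (@ge0_integral_partition _ _ _ (fun n => A n `*` setT))//; last first.
      by apply: measurableT_comp => //; exact: mind.
    apply: eq_eseriesr => n _; rewrite (QE n _ (mind _ _ _ mB) (ind0 _ _ _)).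
    by rewrite (integral_product_snd _ _ (mind _ _ _ mB) (ind0 _ _ _)).
  rewrite [RHS]indE; last exact: mX.
  by apply: eq_integral => z _; rewrite /= !indicE in_setX in_setT.
(* Since the mass is one, normalising changes no value; it turns [s0] into a probability. *)
have s0T : s0 setT = 1.
  by rewrite -setXTT s01// setXTT probability_setT.
have sE B : mnormalize s0 (dirac point) B = s0 B.
  by rewrite /mnormalize s0T onee_eq0/= invr1 mule1.
exists P, Q, (mnormalize s0 (dirac point)); split => //.
- by move=> f mf f0; rewrite -s0E//; apply: eq_measure_integral => B _ _; rewrite -sE.
- by move=> B mB; rewrite -s01// -sE.
- by move=> B mB; rewrite -s02// -sE.
Qed.

End gluing.

(** * Concentration of intermediate measures *)

(** The right side minus the left side is exactly [t * (c ^+ 2 - (b - a) ^+ 2)], and the two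
    triangle inequalities say that [b - a] has absolute value at most [c]. *)
Lemma interpolation_defect (R : realFieldType) (a b c t : R) :
  (0 <= t -> b <= a + c -> a <= b + c -> t * (1 - t) * b ^+ 2 + (a - t * b) ^+ 2
   <= (1 - t) * a ^+ 2 + t * c ^+ 2)%R.
Proof.
move=> t0 bac abc.
have : (0 <= t * (c ^+ 2 - (b - a) ^+ 2))%R.
  apply: mulr_ge0 => //; rewrite subr_sqr; apply: mulr_ge0; lra.
lra.
Qed.

(** The difference of the two sides is [e * (a - 1) ^+ 2]. This turns an error [e] in a distance
    into a small error in the squared cost. *)
Lemma ler_sqr_addl (R : realFieldType) (a e : R) :
  (0 <= e -> (a + e) ^+ 2 <= (1 + e) * (a ^+ 2 + e))%R.
Proof.
by move=> e0; have := mulr_ge0 e0 (sqr_ge0 (a - 1)%R); lra.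
Qed.

Section concentration.
Context {R : realType} {X : completeMetricType R}.
Local Notation dist := (@mdist R X).
Implicit Types mu nu : probability (borel X) R.
Context (sepX : separable X).

Let mdist2 : measurable_fun setT
  (fun z : borel X * borel X => ((dist z.1 z.2) ^+ 2)%:E).
Proof.
by apply/measurable_EFinP/measurable_funX; exact: measurable_mdist.
Qed.

Let mdist2l (x : X) :
  measurable_fun setT (fun y : borel X => ((dist y x) ^+ 2)%:E).
Proof.
by apply/measurable_EFinP/measurable_funX; exact: measurable_mdistl.
Qed.

Let d2_ge0 (x y : X) : 0 <= ((dist x y) ^+ 2)%:E.
Proof. by rewrite lee_fin sqr_ge0. Qed.

(** Here [f n] stands for the distance from one coordinate to the centre of the cell containing the
    other, so it exceeds the true distance by at most [e]. Replacing points of cells by centres thus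
    perturbs the total cost only slightly. *)
Let cell_cost (g : probability (borel X * borel X)%type R)
    (A : nat -> set (borel X * borel X)) (f : nat -> borel X * borel X -> R)
    (e c : R) : (0 <= e)%R ->
  (forall n, measurable (A n)) -> trivIset setT A -> \bigcup_n A n = setT ->
  (forall n, measurable_fun setT (f n)) -> (forall n z, 0 <= f n z)%R ->
  (forall n z, A n z -> f n z <= dist z.1 z.2 + e)%R ->
  \int[g]_z ((dist z.1 z.2) ^+ 2)%:E <= c%:E ->
  \sum_(n <oo) \int[g]_(z in A n) (f n z ^+ 2)%:E <= ((1 + e) * (c + e))%:E.
Proof.
move=> e0 mA tA UA mf f0 fd gc.
have md : measurable_fun setT (fun z : borel X * borel X =>
    (1 + e)%:E * (((dist z.1 z.2) ^+ 2)%:E + e%:E)).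
  by apply: measurable_funeM; apply: emeasurable_funD.
have e1 : (0 <= 1 + e)%R by rewrite addr_ge0.
apply: (@le_trans _ _ (\int[g]_z ((1 + e)%:E * (((dist z.1 z.2) ^+ 2)%:E + e%:E)))).
  rewrite (ge0_integral_partition _ mA tA UA md); last first.
    by move=> z; rewrite mule_ge0 ?lee_fin// addr_ge0// sqr_ge0.
  apply: lee_nneseries => [n _ _|n _].
    by apply: integral_ge0 => z _; rewrite lee_fin sqr_ge0.
  apply: ge0_le_integral => //.
  - by move=> z _; rewrite lee_fin sqr_ge0.
  - by apply/measurable_funTS/measurable_EFinP/measurable_funX.
  - exact: measurable_funTS.
  - move=> z /fd fz; rewrite -EFinD -EFinM lee_fin.
    apply: le_trans (ler_sqr_addl _ e0).
    by rewrite lerXn2r ?nnegrE// addr_ge0// mdist_ge0.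
rewrite ge0_integralZl//; last 2 first.
- by apply: emeasurable_funD.
- by move=> z _; rewrite -EFinD lee_fin addr_ge0// sqr_ge0.
rewrite EFinM lee_wpmul2l ?lee_fin// ge0_integralD//.
by rewrite integral_cst// [X in _ * X](@probability_setT _ _ _ g) mule1 EFinD leeD2r.
Qed.

(** Integrate [interpolation_defect] over [P \x Q], with [z] as the intermediate point; the square
    term is at least [k] on [B0]*[B1], which has full mass. *)
Let cell_defect (P Q : probability (borel X) R) (B0 B1 : set (borel X)) (z : X)
    (t k : R) : (0 < t < 1)%R -> (0 <= k)%R ->
  measurable B0 -> measurable B1 -> P B0 = 1 -> Q B1 = 1 ->
  (forall x y, B0 x -> B1 y -> k <= (dist x z - t * dist x y) ^+ 2)%R ->
  (t * (1 - t))%:E * \int[P \x Q]_p ((dist p.1 p.2) ^+ 2)%:E + k%:E <=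
  (1 - t)%:E * \int[P]_x ((dist x z) ^+ 2)%:E +
  t%:E * \int[Q]_y ((dist y z) ^+ 2)%:E.
Proof.
move=> /andP[/[dup]/ltW t0' t0 t1] k0 mB0 mB1 PB0 QB1 kle.
have t10 : (0 <= 1 - t)%R by rewrite subr_ge0 ltW.
have tt0 : (0 <= t * (1 - t))%R by rewrite mulr_ge0// ltW.
have mB : measurable (B0 `*` B1 : set (borel X * borel X)) by exact: measurableX.
have mk : measurable_fun setT
    (fun p : borel X * borel X => k%:E * (\1_(B0 `*` B1) p)%:E).
  by apply: measurable_funeM; apply/measurable_EFinP; exact: measurable_indic.
have mz1 : measurable_fun setT
    (fun p : borel X * borel X => ((dist p.1 z) ^+ 2)%:E).
  exact: (measurableT_comp (mdist2l z)).
have mz2 : measurable_fun setT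
    (fun p : borel X * borel X => ((dist p.2 z) ^+ 2)%:E).
  exact: (measurableT_comp (mdist2l z)).
(* Writing [k] as the integral of a multiple of an indicator makes the comparison of integrands
   valid at every point. *)
have -> : k%:E = \int[P \x Q]_p (k%:E * (\1_(B0 `*` B1) p)%:E).
  rewrite ge0_integralZl//; last by apply/measurable_EFinP; exact: measurable_indic.
  rewrite integral_indic// setIT [X in _ * X]product_measure1E//.
  by rewrite [X in _ * (X * _)]PB0 [X in _ * (_ * X)]QB1 !mule1.
rewrite -(integral_product_fst P Q (mdist2l z))//.
rewrite -(integral_product_snd P Q (mdist2l z))//.
rewrite -!ge0_integralZl// ?lee_fin//.
have n1 (p : borel X * borel X) : 0 <= (t * (1 - t))%:E * ((dist p.1 p.2) ^+ 2)%:E.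
  by rewrite mule_ge0.
have n2 (p : borel X * borel X) : 0 <= k%:E * (\1_(B0 `*` B1) p)%:E.
  by rewrite mule_ge0 ?lee_fin.
have n3 (p : borel X * borel X) : 0 <= (1 - t)%:E * ((dist p.1 z) ^+ 2)%:E.
  by rewrite mule_ge0.
have n4 (p : borel X * borel X) : 0 <= t%:E * ((dist p.2 z) ^+ 2)%:E.
  by rewrite mule_ge0.
have m1 := measurable_funeM (t * (1 - t))%:E mdist2.
have m3 := measurable_funeM (1 - t)%:E mz1.
have m4 := measurable_funeM t%:E mz2.
rewrite -!ge0_integralD//.
apply: ge0_le_integral => //.
- by move=> p _; rewrite adde_ge0.
- exact: emeasurable_funD.
- exact: emeasurable_funD.
move=> p _; rewrite -!EFinM -!EFinD lee_fin.
have tr1 : (dist p.1 p.2 <= dist p.1 z + dist p.2 z)%R.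
  by rewrite (metric_sym p.2); exact: metric_triangle.
apply: le_trans (interpolation_defect t0' tr1 (metric_triangle _ _ _)).
rewrite lerD2l indicE.
have [/set_mem[B0p B1p]|_] := boolP (p \in _); rewrite ?mulr1 ?mulr0 ?sqr_ge0//.
exact: kle.
Qed.

(** If the law of [f] under [g] does not charge the complement of [B], neither does its conditional
    law on a cell of nonzero mass [c]. *)
Let cell_full d (T : measurableType d) (g : probability T R)
    (f : T -> borel X) (P : probability (borel X) R) (A : set T)
    (B : set (borel X)) (c : \bar R) : measurable_fun setT f ->
  measurable A -> measurable B ->
  \int[g]_(x in A) (\1_(~` B) (f x))%:E = c * \int[P]_x (\1_(~` B) x)%:E ->
  g (f @^-1` (~` B)) = 0 -> c != 0 -> P B = 1.
Proof.
move=> mf mA mB gP g0 c0.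
have mBC := measurableC mB.
have mfB : measurable (f @^-1` (~` B)).
  by rewrite -[X in measurable X]setTI; exact: mf.
have mg : measurable_fun setT (fun x => (\1_(~` B) (f x) : R)%:E).
  by apply/measurable_EFinP; apply: measurableT_comp => //; exact: measurable_indic.
have : \int[g]_(x in A) (\1_(~` B) (f x))%:E <= 0.
  apply: (@le_trans _ _ (\int[g]_x (\1_(~` B) (f x))%:E)).
    by apply: ge0_subset_integral => //.
  rewrite (_ : (fun x => _) = fun x => (\1_(f @^-1` (~` B)) x)%:E)//.
  by rewrite integral_indic// setIT [leLHS]g0.
have PE : \int[P]_x (\1_(~` B) x)%:E = P (~` B) by rewrite integral_indic// setIT.
move=> gle0; rewrite PE in gP.
have : c * P (~` B) == 0.
  by rewrite -gP eq_le gle0/=; apply: integral_ge0 => x _; rewrite lee_fin.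
rewrite mule_eq0 (negbTE c0)/= => /eqP PC0.
by rewrite -[B]setCK probability_setC// PC0 sube0.
Qed.

(** The cost hypotheses are those of a time-[t] point of a geodesic whose squared length is [w]. The
    threshold comes from the triangle inequality: a point within [t * dist x y] of [x], with [x] and
    [y] in the balls of radii [r0] and [r1], is within [r0 + t * (r0 + r1)] of [x0]. *)
Lemma intermediate_concentration mu0 mu1 nu (t w r0 r1 s : R) (x0 : X) :
  (0 < t < 1)%R ->
  (forall g, coupling mu0 mu1 g -> w%:E <= \int[g]_z ((dist z.1 z.2) ^+ 2)%:E) ->
  (forall e : R, (0 < e)%R -> exists2 g, coupling mu0 nu g &
    \int[g]_z ((dist z.1 z.2) ^+ 2)%:E <= (t ^+ 2 * w + e)%:E) ->
  (forall e : R, (0 < e)%R -> exists2 g, coupling nu mu1 g &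
    \int[g]_z ((dist z.1 z.2) ^+ 2)%:E <= ((1 - t) ^+ 2 * w + e)%:E) ->
  mu0 (~` ball x0 r0) = 0 -> mu1 (~` ball x0 r1) = 0 ->
  (r0 + t * (r0 + r1) < s)%R -> nu (~` ball x0 s) = 0.
Proof.
move=> t01 w01 w0t wt1 mu0B mu1B thr; have /andP[t0 t1] := t01.
have t10 : (0 <= 1 - t)%R by rewrite subr_ge0 ltW.
(* Half of the slack in the threshold; the other half absorbs the cell size [e <= k]. *)
pose k : R := ((s - (r0 + t * (r0 + r1))) / 2)%R.
have k0 : (0 < k)%R by rewrite divr_gt0// subr_gt0.
have mBC (r : R) : measurable (~` ball x0 r : set (borel X)).
  exact: (measurableC (measurable_borel_ball x0 r)).
suff key (e : R) : (0 < e)%R -> (e <= k)%R -> (k ^+ 2)%:E * nu (~` ball x0 s) <=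
    (e * (t * (1 - t) * w + 2 + 2 * e))%:E.
  pose N := fine (nu (~` ball x0 s)).
  have NE : nu (~` ball x0 s) = N%:E by rewrite fineK// fin_num_measure.
  have N0 : (0 <= N)%R by rewrite fine_ge0.
  rewrite NE; congr EFin; apply/eqP; rewrite eq_le N0 andbT leNgt; apply/negP => Np.
  pose C := (`|t * (1 - t) * w| + 2 + 2 * k)%R.
  have C0 : (0 < C)%R by rewrite /C; have := normr_ge0 (t * (1 - t) * w)%R; lra.
  (* If the escaping mass [N] were positive, this [e] would make the error at most half of
     [k ^+ 2 * N], because [C] bounds the bracket for all [e <= k]. *)
  have kN0 : (0 < k ^+ 2 * N)%R by rewrite mulr_gt0// exprn_gt0.
  pose e := Num.min k (k ^+ 2 * N / (2 * C))%R.
  have e0 : (0 < e)%R by rewrite lt_min k0/= divr_gt0// mulr_gt0.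
  have ek : (e <= k)%R by rewrite ge_min lexx.
  have eC : (e * (2 * C) <= k ^+ 2 * N)%R.
    by rewrite -ler_pdivlMr ?mulr_gt0// ge_min lexx orbT.
  have := key e e0 ek; rewrite NE -EFinM lee_fin.
  suff : (e * (t * (1 - t) * w + 2 + 2 * e) <= e * C)%R by lra.
  rewrite ler_pM2l// /C; have := ler_norm (t * (1 - t) * w)%R; lra.
move=> e0 ek.
have [A [z [mA tA UA Az]]] := small_partition sepX e0.
have [g1 cg1 g1le] := w0t _ e0.
have [g2 cg2 g2le] := wt1 _ e0.
have g1A B : measurable B -> g1 (setT `*` B) = nu B by move=> /cg1[].
have g2A B : measurable B -> g2 (B `*` setT) = nu B by move=> /cg2[].
have [|P [Q [sg [PE QE sgE sg1 sg2]]]] := gluing mA tA UA (g1 := g1) (g2 := g2).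
  by move=> B mB; rewrite g1A// g2A.
(* The glued plan is a competitor between [mu0] and [mu1], so its cost is at least [w]. *)
have csg : coupling mu0 mu1 sg.
  by move=> B mB; rewrite sg1// sg2// (cg1 _ mB).1 (cg2 _ mB).2.
(* Contributions of the [n]-th cell: [a] and [c] are the costs from its centre to either side, [b]
   is the cost of the glued plan, and [v] is the mass outside the ball. *)
pose a n := \int[g1]_(p in setT `*` A n) (dist p.1 (z n) ^+ 2)%:E.
pose c n := \int[g2]_(p in A n `*` setT) (dist p.2 (z n) ^+ 2)%:E.
pose b n := g1 (setT `*` A n) * \int[P n \x Q n]_p (dist p.1 p.2 ^+ 2)%:E.
pose v n := nu (~` ball x0 s `&` A n).
have a0 n : 0 <= a n by apply: integral_ge0 => p _.
have c0 n : 0 <= c n by apply: integral_ge0 => p _.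
have b0 n : 0 <= b n by rewrite mule_ge0//; apply: integral_ge0 => p _.
have cell n : (t * (1 - t))%:E * b n + (k ^+ 2)%:E * v n <=
    (1 - t)%:E * a n + t%:E * c n.
  have wn : g1 (setT `*` A n) = nu (A n) by rewrite g1A.
  rewrite /a /c (PE n _ (mdist2l (z n)))// (QE n _ (mdist2l (z n)))// /b wn.
  have vA : v n <= nu (A n).
    by apply: le_measure; rewrite ?inE//; exact: measurableI.
  have [nuA0|nuA0] := eqVneq (nu (A n)) 0.
    have -> : v n = 0 by apply/eqP; rewrite eq_le -{1}nuA0 vA/=.
    by rewrite nuA0 !mul0e !mule0 adde0.
  have PB : P n (ball x0 r0) = 1.
    have mE := @measurable_indic _ (borel X) R setT _ (mBC r0).
    apply: (@cell_full _ _ g1 fst _ (setT `*` A n) _ (nu (A n))) => //.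
    - exact: (measurableX measurableT (mA n)).
    - exact: measurable_borel_ball.
    - by rewrite -wn; apply: PE => //; exact/measurable_EFinP.
    - rewrite -mu0B -(cg1 _ (mBC r0)).1; congr (g1 _).
      by apply/seteqP; split=> p //= [].
  have QB : Q n (ball x0 r1) = 1.
    have mE := @measurable_indic _ (borel X) R setT _ (mBC r1).
    apply: (@cell_full _ _ g2 snd _ (A n `*` setT) _ (nu (A n))) => //.
    - exact: (measurableX (mA n) measurableT).
    - exact: measurable_borel_ball.
    - by rewrite -wn; apply: QE => //; exact/measurable_EFinP.
    - rewrite -mu1B -(cg2 _ (mBC r1)).2; congr (g2 _).
      by apply/seteqP; split=> p //= [].
  (* The lower bound [k ^+ 2] is available only for a cell that meets the complement of the ball;
     for the other cells [v n] vanishes and zero suffices. *)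
  pose kn := if `[< ~` ball x0 s `&` A n !=set0 >] then (k ^+ 2)%R else 0%R.
  have kn0 : (0 <= kn)%R by rewrite /kn; case: ifP => // _; rewrite sqr_ge0.
  have kv : (k ^+ 2)%:E * v n <= kn%:E * nu (A n).
    rewrite /kn; case: asboolP => [_|/nonemptyPn E0].
      by rewrite lee_wpmul2l// lee_fin sqr_ge0.
    by rewrite /v E0 measure0 mule0 mul0e.
  have knle x y : ball x0 r0 x -> ball x0 r1 y ->
      (kn <= (dist x (z n) - t * dist x y) ^+ 2)%R.
    rewrite !ballEmdist /= => xr0 yr1; rewrite /kn.
    case: asboolP => [[u [+ Au]]|_]; last by rewrite sqr_ge0.
    rewrite ballEmdist /= => /negP; rewrite -leNgt => us.
    (* A point [u] of the cell outside the ball forces the centre, which is within [e] of [u], to be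
       far from [x]. *)
    suff kd : (k <= dist x (z n) - t * dist x y)%R.
      by rewrite lerXn2r ?nnegrE ?(ltW k0)// (le_trans _ kd)// ltW.
    have xy : (t * dist x y <= t * (r0 + r1))%R.
      rewrite ler_pM2l//; have := metric_triangle x x0 y.
      rewrite (metric_sym x x0); lra.
    have := Az n u Au; have := metric_triangle x0 x u.
    have := metric_triangle x (z n) u; rewrite (metric_sym (z n)).
    move: k0 ek; rewrite /k; lra.
  have := cell_defect t01 kn0 (measurable_borel_ball _ _) (measurable_borel_ball _ _) PB QB knle.
  set Ib := \int[P n \x Q n]_p _; set Ia := \int[P n]_p _; set Ic := \int[Q n]_p _.
  have Ib0 : 0 <= Ib by apply: integral_ge0 => p _.
  have Ia0 : 0 <= Ia by apply: integral_ge0 => p _.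
  have Ic0 : 0 <= Ic by apply: integral_ge0 => p _.
  move=> ineq; apply: le_trans (leeD2l _ kv) _.
  rewrite ![_ * (nu (A n) * _)]muleCA [kn%:E * _]muleC.
  rewrite -!ge0_muleDr ?mule_ge0 ?lee_fin ?mulr_ge0 ?(ltW t0)//.
  exact: lee_wpmul2l.
have suma : \sum_(n <oo) a n <= ((1 + e) * (t ^+ 2 * w + e + e))%:E.
  apply: (@cell_cost _ (fun n => setT `*` A n) (fun n p => dist p.1 (z n))) => //.
  - exact: ltW.
  - by move=> n; exact: measurableX.
  - by apply/trivIsetP => i j _ _ ij; rewrite -setXI (iffLR trivIsetP tA)// setX0.
  - rewrite -subTset => p _; have [n _ Ap] : (\bigcup_n A n) p.2 by rewrite UA.
    by exists n.
  - by move=> n; exact: (measurableT_comp (measurable_mdistl (z n))).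
  - by move=> n p; exact: mdist_ge0.
  - move=> n p [_ /Az Ap]; apply: le_trans (metric_triangle _ p.2 _) _.
    by rewrite lerD2l ltW.
have sumc : \sum_(n <oo) c n <= ((1 + e) * ((1 - t) ^+ 2 * w + e + e))%:E.
  apply: (@cell_cost _ (fun n => A n `*` setT) (fun n p => dist p.2 (z n))) => //.
  - exact: ltW.
  - by move=> n; exact: measurableX.
  - by apply/trivIsetP => i j _ _ ij; rewrite -setXI (iffLR trivIsetP tA)// set0X.
  - rewrite -subTset => p _; have [n _ Ap] : (\bigcup_n A n) p.1 by rewrite UA.
    by exists n.
  - by move=> n; exact: (measurableT_comp (measurable_mdistl (z n))).
  - by move=> n p; exact: mdist_ge0.
  - move=> n p [/Az Ap _]; apply: le_trans (metric_triangle _ p.1 _) _.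
    by rewrite (metric_sym p.2) lerD2l ltW.
have sumb : w%:E <= \sum_(n <oo) b n by rewrite -sgE//; exact: w01.
have sumv : \sum_(n <oo) v n = nu (~` ball x0 s).
  rewrite -[in RHS](setIT (~` _)) -UA setI_bigcupr.
  have mBA n : measurable (~` ball x0 s `&` A n : set (borel X)) by exact: measurableI.
  rewrite measure_semi_bigcup//; first exact: trivIset_setIl.
  exact: bigcup_measurable.
have k20 : 0 <= (k ^+ 2)%:E by rewrite lee_fin sqr_ge0.
have t0' : 0 <= t%:E by rewrite lee_fin ltW.
have tt0 : (0 <= t * (1 - t))%R by rewrite mulr_ge0// ltW.
(* Summing the cell estimates compares the glued cost and the escaping mass with the costs of the
   two given plans. *)
have : \sum_(n <oo) ((t * (1 - t))%:E * b n + (k ^+ 2)%:E * v n) <=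
    \sum_(n <oo) ((1 - t)%:E * a n + t%:E * c n).
  apply: lee_nneseries => // n _ _.
  by rewrite adde_ge0// mule_ge0.
rewrite !nneseriesD//; last 4 first.
- by move=> n _ _; rewrite mule_ge0.
- by move=> n _ _; rewrite mule_ge0.
- by move=> n _ _; rewrite mule_ge0.
- by move=> n _ _; rewrite mule_ge0.
rewrite !nneseriesZl// sumv => sumle.
have : (t * (1 - t) * w)%:E + (k ^+ 2)%:E * nu (~` ball x0 s) <=
    ((1 - t) * ((1 + e) * (t ^+ 2 * w + e + e)) +
     t * ((1 + e) * ((1 - t) ^+ 2 * w + e + e)))%:E.
  apply: (@le_trans _ _ ((t * (1 - t))%:E * \sum_(n <oo) b n +
      (k ^+ 2)%:E * nu (~` ball x0 s))).
    by apply: leeD2r; rewrite EFinM; exact: lee_wpmul2l.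
  apply: (le_trans sumle).
  by rewrite [leRHS]EFinD; apply: leeD; rewrite [leRHS]EFinM; exact: lee_wpmul2l.
(* The leading terms match because [(1 - t) * t ^+ 2 + t * (1 - t) ^+ 2 = t * (1 - t)]; cancelling
   them leaves an error of order [e]. *)
have -> : ((1 - t) * ((1 + e) * (t ^+ 2 * w + e + e)) +
     t * ((1 + e) * ((1 - t) ^+ 2 * w + e + e)) =
     t * (1 - t) * w + e * (t * (1 - t) * w + 2 + 2 * e))%R by ring.
by rewrite [leRHS]EFinD leeD2lE.
Qed.

End concentration.

(** * Entropy bounds and the entropy of uniform measures *)

Section entropy.
Context {R : realType} {X : completeMetricType R}.
Context (m : {measure set (borel X) -> \bar R}).
Implicit Type mu : probability (borel X) R.

Import HBNNSimple.

(** For a simple function below [f], the defining property of the density is summed over its values;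
    the integral of [f] is the supremum over such functions. *)
Lemma le_integral_density mu (rho : borel X -> R) (f : borel X -> \bar R) :
  is_density m mu rho -> measurable_fun setT f -> (forall x, 0 <= f x) ->
  \int[mu]_x f x <= \int[m]_x (f x * (rho x)%:E).
Proof.
move=> [mrho rho0 muE] mf f0.
have mErho : measurable_fun setT (EFin \o rho) by exact/measurable_EFinP.
rewrite ge0_integralTE//; apply: ge_ereal_sup => _ [h /= hf <-].
have -> : sintegral mu h = \int[m]_x ((h x)%:E * (rho x)%:E).
  transitivity (\int[m]_x (\sum_(y \in range h)
      (y * \1_(h @^-1` [set y]) x)%:E * (rho x)%:E)); last first.
    apply: eq_integral => x _; rewrite -ge0_mule_fsuml => [|y]; last first.
      exact: nnfun_muleindic_ge0.
    by rewrite fsumEFin// -fimfunE.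
  rewrite ge0_integral_fsum//; last 2 first.
  - move=> y; apply: emeasurable_funM => //.
    by apply/measurable_EFinP; exact: measurable_funM.
  - move=> y x _; apply: mule_ge0; first exact: nnfun_muleindic_ge0.
    by rewrite lee_fin.
  rewrite sintegralE; apply: eq_fsbigr => y /[!inE] -[x0 _ hx0].
  have y0 : (0 <= y)%R by rewrite -hx0.
  rewrite [X in _ * X = _]muE// [in LHS]integral_mkcond.
  rewrite -[LHS]ge0_integralZl//; last 2 first.
  - by apply/(measurable_restrictT _ _).1 => //; exact: measurable_funTS.
  - by move=> x _; apply: erestrict_ge0 => z _; rewrite lee_fin.
  apply: eq_integral => x _; rewrite patchE indicE EFinM -muleA.
  by case: ifPn; rewrite ?mul1e ?mul0e.
apply: ge0_le_integral => //.
- by move=> x _; rewrite mule_ge0// lee_fin.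
- by apply: emeasurable_funM => //; exact/measurable_EFinP.
- exact: emeasurable_funM.
- by move=> x _; rewrite lee_wpmul2r ?lee_fin// hf.
Qed.

Lemma density_null mu (rho : borel X -> R) (N : set (borel X)) :
  is_density m mu rho -> measurable N -> m N = 0 -> mu N = 0.
Proof.
move=> [mrho _ muE] mN mN0; rewrite muE//; apply: null_set_integral => //.
exact/measurable_EFinP/measurable_funTS.
Qed.

(* Jensen's inequality, through [ln y <= y - 1] at [y = 1 / (c * rho)]. *)
Lemma Ent_ge mu (S : set (borel X)) (c : R) : measurable S ->
  mu (~` S) = 0 -> m S = c%:E -> (0 < c)%R -> (- ln c)%:E <= Ent m mu.
Proof.
move=> mS muS mSc c0; rewrite /Ent; case: pselect => [h|_]; last exact: leey.
have := svalP (cid h); set rho := sval (cid h) => drho; have [mrho rho0 muE] := drho.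
set L := fun x => (ln (rho x))%:E.
case: ifPn => [_|Lfin]; first exact: leey.
have mL : measurable_fun setT L by apply/measurable_EFinP; exact: measurableT_comp.
have mErho : measurable_fun setT (EFin \o rho) by exact/measurable_EFinP.
(* On [S] this is [1 / (c * rho)] where [rho > 0]. Where [rho = 0] the convention [ln 0 = 0] gives a
   finite value, which the factor [rho] kills in [intD]. *)
pose D x := (expR (- ln (c * rho x)) * \1_S x)%:E.
have mD : measurable_fun setT D.
  apply/measurable_EFinP/measurable_funM; last exact: measurable_indic.
  apply: measurableT_comp => //; apply: measurableT_comp => //.
  by apply: measurableT_comp => //; exact: measurable_funM.
have D0 x : 0 <= D x by rewrite lee_fin mulr_ge0// expR_ge0.
have DE x : (0 < rho x)%R -> D x = ((c * rho x)^-1 * \1_S x)%:E.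
  by move=> rx; rewrite /D expRN lnK// posrE mulr_gt0.
have intD : \int[mu]_x D x <= 1.
  apply: le_trans (le_integral_density drho mD D0) _.
  apply: (@le_trans _ _ (\int[m]_x (c^-1%:E * (\1_S x)%:E))).
    apply: ge0_le_integral => //.
    - by move=> x _; rewrite mule_ge0// lee_fin.
    - exact: emeasurable_funM.
    - by apply: measurable_funeM; apply/measurable_EFinP; exact: measurable_indic.
    - move=> x _; have [rx|] := ltP 0%R (rho x); last first.
        move=> rx; have -> : rho x = 0%R by apply/eqP; rewrite eq_le rx rho0.
        by rewrite mule0 -EFinM lee_fin mulr_ge0// invr_ge0 ltW.
      by rewrite DE// -!EFinM lee_fin invfM mulrAC mulfVK ?gt_eqF.
  rewrite ge0_integralZl ?integral_indic ?setIT ?mSc//; last 2 first.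
  - by apply/measurable_EFinP; exact: measurable_indic.
  - by rewrite lee_fin invr_ge0 ltW.
  by rewrite -EFinM mulVf ?gt_eqF.
(* These constants satisfy [p - q = ln c] and are nonnegative, so that [- ln rho <= ln c + D - 1]
   can be rearranged into an inequality between nonnegative functions. *)
pose p := `|ln c|%R; pose q := (`|ln c| - ln c)%R.
have p0 : (0 <= p)%R by exact: normr_ge0.
have q0 : (0 <= q)%R by rewrite subr_ge0 ler_norm.
have mZ : measurable [set x : borel X | rho x = 0%R].
  by have := mrho measurableT _ (measurable_set1 0%R); rewrite setTI.
have muZ : mu [set x : borel X | rho x = 0%R] = 0.
  rewrite muE// -[RHS](integral0 m [set x : borel X | rho x = 0%R]).
  by apply: eq_integral => x /[!inE] /= ->.
have main : \int[mu]_x (L^\- x + (1 + q)%:E) <= \int[mu]_x (L^\+ x + (p%:E + D x)).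
  apply: ae_ge0_le_integral => //.
  - by move=> x _; rewrite adde_ge0// lee_fin addr_ge0.
  - by apply: emeasurable_funD => //; exact: measurable_funeneg.
  - by move=> x _; rewrite !adde_ge0// lee_fin.
  - apply: emeasurable_funD; first exact: measurable_funepos.
    exact: emeasurable_funD.
  (* The pointwise inequality may fail only outside [S] or where [rho] vanishes, and both sets are
     [mu]-null. *)
  - exists (~` S `|` [set x : borel X | rho x = 0%R]); split.
    + by apply: measurableU => //; exact: measurableC.
    + by rewrite measureU0//; exact: measurableC.
    + move=> x /= nle; apply: contrapT => /not_orP[/contrapT Sx /eqP rx0]; apply: nle => _.
      have rx : (0 < rho x)%R by rewrite lt_neqAle eq_sym rx0 rho0.
      have crx : (0 < (c * rho x)^-1)%R by rewrite invr_gt0 mulr_gt0.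
      rewrite DE// indicE mem_set// mulr1.
      have := @le_ln1Dx _ ((c * rho x)^-1 - 1)%R.
      rewrite [X in ln X]addrC subrK lnV ?posrE ?mulr_gt0// lnM ?posrE//.
      move=> /(_ _)/wrap[|lnle]; first lra.
      rewrite funenegE funeposE /L -EFinN -!EFin_max -!EFinD lee_fin /p /q.
      have -> : (Num.max (- ln (rho x)) 0 = Num.max (ln (rho x)) 0 - ln (rho x))%R.
        by case: (leP 0%R (ln (rho x))); case: (leP (- ln (rho x)) 0)%R; lra.
      lra.
have mLn := measurable_funeneg mL; have mLp := measurable_funepos mL.
have q1 : 0 <= (1 + q)%:E by rewrite lee_fin addr_ge0.
have pE : 0 <= p%:E by rewrite lee_fin.
have pD x : 0 <= p%:E + D x by rewrite adde_ge0.
have mpD : measurable_fun setT (fun x => p%:E + D x) by exact: emeasurable_funD.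
move: main; rewrite !ge0_integralD//.
rewrite !integral_cst//.
rewrite [X in _ + _ * X <= _](@probability_setT _ _ _ mu).
rewrite [X in _ <= _ + (_ * X + _)](@probability_setT _ _ _ mu) !mule1.
move=> main; rewrite [leRHS]integralE; move: main.
have Lp0 : 0 <= \int[mu]_x L^\+ x by exact: integral_ge0.
have Ln0 : 0 <= \int[mu]_x L^\- x by exact: integral_ge0.
have iD0 : 0 <= \int[mu]_x D x by exact: integral_ge0.
(* With the integral of [L^\+] finite and that of [D] at most one, [main] also excludes an infinite
   integral of [L^\-]; real arithmetic remains. *)
move: Lfin Lp0 Ln0 iD0 intD.
case: (\int[mu]_x L^\+ x) => [lp| |] //; case: (\int[mu]_x L^\- x) => [ln'| |] //;
  case: (\int[mu]_x D x) => [dd| |] //.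
move=> _; rewrite -?EFinN -!EFinD !lee_fin /p /q => *. lra.
Qed.

(** [Ent] evaluates a density picked by choice. By uniqueness almost everywhere it equals [1 / c] on
    [B] up to a [mu]-null set, so its logarithm is [mu]-a.e. the constant [- ln c]. *)
Lemma Ent_uniform mu (B : set (borel X)) (c : R) : measurable B ->
  m B = c%:E -> (0 < c)%R ->
  (forall A : set (borel X), measurable A -> mu A = c^-1%:E * m (A `&` B)) ->
  Ent m mu = (- ln c)%:E.
Proof.
move=> mB mBc c0 muE.
pose rho0 : borel X -> R := fun x => (c^-1 * \1_B x)%R.
have ic0 : (0 <= c^-1)%R by rewrite invr_ge0 ltW.
have drho0 : is_density m mu rho0.
  split.
  - by apply: measurable_funM => //; exact: measurable_indic.
  - by move=> x; rewrite mulr_ge0.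
  - move=> A mA; rewrite muE// /rho0; under eq_integral do rewrite EFinM.
    rewrite ge0_integralZl//; last by apply/measurable_EFinP; exact: measurable_indic.
    by rewrite integral_indic// setIC.
have muB : mu (~` B) = 0.
  by rewrite muE ?setICl ?measure0 ?mule0//; exact: measurableC.
rewrite /Ent; case: pselect => [h|]; last by move=> /(_ (ex_intro _ _ drho0)).
have := svalP (cid h); set rho := sval (cid h) => drho.
set L := fun x => (ln (rho x))%:E.
have mL : measurable_fun setT L.
  by apply/measurable_EFinP; apply: measurableT_comp => //; case: drho.
have aeL : ae_eq mu setT L (cst (- ln c)%:E).
  have : ae_eq m setT (EFin \o rho0) (EFin \o rho).
    apply: integral_ae_eq => //.
    - apply/integrableP; split; first by apply/measurable_EFinP; case: drho0.
      under eq_integral.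
        move=> x _; rewrite /= ger0_norm; last by case: drho0.
        over.
      case: drho0 => _ _ <-//.
      by rewrite probability_setT ltry.
    - by apply/measurable_EFinP; case: drho.
    - by move=> A _ mA; case: drho0 => _ _ <-//; case: drho => _ _ <-.
  move=> [N [mN mN0 sN]]; exists (N `|` ~` B); split.
  - by apply: measurableU => //; exact: measurableC.
  - have muN := density_null drho mN mN0.
    by rewrite measureU0//; exact: measurableC.
  - move=> x /= nLx; apply: contrapT => /not_orP[Nx /contrapT Bx]; apply: nLx => _.
    have : EFin (rho0 x) = EFin (rho x).
      by apply: contrapT => ne; apply: Nx; apply: sN => /= /(_ I).
    by rewrite /L /rho0 indicE mem_set// mulr1 => -[<-]; rewrite lnV// posrE.
(* The positive part has finite integral, so the test in [Ent] selects the integral of [ln rho]. *)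
have -> : \int[mu]_x L^\+ x = (Num.max (- ln c) 0)%:E.
  have /ae_eq_funeposneg[Lp _] := aeL.
  rewrite (ge0_ae_eq_integral _ _ _ _ _ Lp)//.
    rewrite (eq_integral (cst (Num.max (- ln c) 0)%:E)); last first.
      by move=> x _; rewrite funeposE EFin_max.
    rewrite integral_cst//.
    by rewrite [X in _ * X](@probability_setT _ _ _ mu) mule1.
  - exact: measurable_funepos.
  - exact: measurable_funepos.
rewrite /=; transitivity (\int[mu]_x cst (- ln c)%:E x); first exact: ae_eq_integral.
by rewrite integral_cst// [X in _ * X](@probability_setT _ _ _ mu) mule1.
Qed.

End entropy.

(** * A Brunn-Minkowski inequality for concentric balls *)

Lemma mnormalizeE d (T : measurableType d) (R : realType)
    (mu : {measure set T -> \bar R}) (P : probability T R) (c : R) (A : set T) :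
  mu setT = c%:E -> (0 < c)%R -> mnormalize mu P A = c^-1%:E * mu A.
Proof.
by move=> muT c0; rewrite /mnormalize muT eqe gt_eqF//= muleC.
Qed.

Section brunn_minkowski.
Context {R : realType} {X : completeMetricType R}.
Context (m : {measure set (borel X) -> \bar R}).
Implicit Types mu nu : probability (borel X) R.
Local Notation dist := (@mdist R X).

(** The square of [W2]; working with it avoids square roots in the estimates on plans. *)
Let cost mu nu := ereal_inf [set \int[gamma]_z ((dist z.1 z.2) ^+ 2)%:E
                            | gamma in coupling mu nu].

Lemma measure_ball_gt0 (x : X) (r : R) : msupport m = setT -> (0 < r)%R ->
  0 < m (ball x r).
Proof.
move=> supp r0; have sx : msupport m x by rewrite supp.
apply: lt_le_trans (sx (interior (ball x r)) _) _.
  split; first exact: open_interior.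
  exact: nbhsx_ballx.
apply: le_measure; rewrite ?inE.
- by apply: sub_sigma_algebra; exact: open_interior.
- exact: measurable_borel_ball.
- exact: interior_subset.
Qed.

Lemma uniform_probability (B : set (borel X)) (c : R) : measurable B ->
  m B = c%:E -> (0 < c)%R ->
  exists mu, forall A : set (borel X), measurable A -> mu A = c^-1%:E * m (A `&` B).
Proof.
move=> mB mBc c0; exists (mnormalize (mrestr m mB) (dirac point)) => A mA.
have mT : mrestr m mB setT = c%:E by rewrite /mrestr setTI.
exact: (@mnormalizeE _ _ _ (mrestr m mB) _ c A mT c0).
Qed.

Lemma second_moment_ball mu (x0 : X) (r : R) : mu (~` ball x0 r) = 0 ->
  \int[mu]_x ((dist x x0) ^+ 2)%:E < +oo.
Proof.
move=> muB; apply: (@le_lt_trans _ _ (\int[mu]_x (r ^+ 2)%:E)); last first.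
  by rewrite integral_cst// [X in _ * X](@probability_setT _ _ _ mu) mule1 ltry.
apply: ae_ge0_le_integral => //.
- by move=> x _; rewrite lee_fin sqr_ge0.
- by apply/measurable_EFinP/measurable_funX; exact: measurable_mdistl.
- by move=> x _; rewrite lee_fin sqr_ge0.
- exists (~` ball x0 r); split => //.
    exact: (measurableC (measurable_borel_ball x0 r)).
  move=> x /= nx; rewrite ballEmdist => /= x0x; apply: nx => _.
  have d0 := mdist_ge0 x x0; rewrite metric_sym in x0x.
  by rewrite lee_fin lerXn2r ?nnegrE// ?ltW// (le_lt_trans d0).
Qed.

(** The product plan has finite cost, since [(a + b) ^+ 2 <= 2 * a ^+ 2 + 2 * b ^+ 2] for the
    distances to [x0]. *)
Lemma cost_lty mu nu (x0 : X) : separable X ->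
  \int[mu]_x ((dist x x0) ^+ 2)%:E < +oo ->
  \int[nu]_x ((dist x x0) ^+ 2)%:E < +oo -> cost mu nu < +oo.
Proof.
move=> sepX mufin nufin.
have md : measurable_fun setT (fun x : borel X => ((dist x x0) ^+ 2)%:E).
  by apply/measurable_EFinP/measurable_funX; exact: measurable_mdistl.
have mdd : measurable_fun setT
    (fun z : borel X * borel X => ((dist z.1 z.2) ^+ 2)%:E).
  by apply/measurable_EFinP/measurable_funX; exact: measurable_mdist.
pose g := mnormalize (mu \x nu) (dirac point).
have gE A : g A = (mu \x nu) A.
  rewrite /g (@mnormalizeE _ _ _ _ _ 1) ?invr1 ?mul1e// -setXTT.
  rewrite [LHS]product_measure1E// [X in X * _](@probability_setT _ _ _ mu) mul1e.
  exact: probability_setT.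
apply: (@le_lt_trans _ _ (\int[mu \x nu]_z ((dist z.1 z.2) ^+ 2)%:E)).
  apply: ereal_inf_lbound; exists g.
    move=> A mA; split; rewrite [LHS]gE [LHS]product_measure1E//.
      by rewrite [X in _ * X](@probability_setT _ _ _ nu) mule1.
    by rewrite [X in X * _](@probability_setT _ _ _ mu) mul1e.
  by apply: eq_measure_integral => A _ _; exact: gE.
have d20 (x y : X) : 0 <= ((dist x y) ^+ 2)%:E by rewrite lee_fin sqr_ge0.
have m1 : measurable_fun setT
    (fun z : borel X * borel X => 2%:E * ((dist z.1 x0) ^+ 2)%:E).
  by apply: measurable_funeM; exact: (measurableT_comp md).
have m2 : measurable_fun setT
    (fun z : borel X * borel X => 2%:E * ((dist z.2 x0) ^+ 2)%:E).
  by apply: measurable_funeM; exact: (measurableT_comp md).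
apply: (@le_lt_trans _ _ (\int[mu \x nu]_z
    (2%:E * ((dist z.1 x0) ^+ 2)%:E + 2%:E * ((dist z.2 x0) ^+ 2)%:E))).
  apply: ge0_le_integral => //.
  - exact: emeasurable_funD.
  - move=> z _; rewrite -!EFinM -EFinD lee_fin.
    have := metric_triangle z.1 x0 z.2; rewrite (metric_sym x0) => tr.
    have d0 := mdist_ge0 z.1 z.2.
    apply: (@le_trans _ _ ((dist z.1 x0 + dist z.2 x0) ^+ 2)%R).
      by rewrite lerXn2r ?nnegrE// (le_trans d0).
    have := sqr_ge0 (dist z.1 x0 - dist z.2 x0)%R; lra.
rewrite ge0_integralD//; last 2 first.
- by move=> z _; rewrite mule_ge0.
- by move=> z _; rewrite mule_ge0.
rewrite (integral_product_fst mu nu (f := fun x => 2%:E * ((dist x x0) ^+ 2)%:E)).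
rewrite (integral_product_snd mu nu (f := fun x => 2%:E * ((dist x x0) ^+ 2)%:E)).
rewrite !ge0_integralZl//.
by rewrite lte_add_pinfty// lte_mul_pinfty.
all: by [exact: measurable_funeM | move=> z; rewrite mule_ge0].
Qed.

Lemma cost_ge0 mu nu : 0 <= cost mu nu.
Proof.
apply: le_ereal_inf_tmp => _ [g _ <-]; apply: integral_ge0 => z _.
by rewrite lee_fin sqr_ge0.
Qed.

Lemma cost_W2 mu nu mu' nu' (c w : R) : (0 <= c)%R -> cost mu nu = w%:E ->
  W2 mu' nu' = c%:E * W2 mu nu -> cost mu' nu' = (c ^+ 2 * w)%:E.
Proof.
move=> c0 costw; rewrite /W2 -!/(cost _ _) costw => W.
have w0 : (0 <= w)%R by rewrite -lee_fin -costw cost_ge0.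
have sw : sqrte w%:E = (Num.sqrt w)%:E by [].
by rewrite -(sqr_sqrte (cost_ge0 mu' nu')) W sw -EFinM -EFin_expe exprMn sqr_sqrtr.
Qed.

Lemma cost_adherent mu nu (w : R) : cost mu nu = w%:E ->
  forall e : R, (0 < e)%R -> exists2 g, coupling mu nu g &
    \int[g]_z ((dist z.1 z.2) ^+ 2)%:E <= (w + e)%:E.
Proof.
move=> costw e e0.
have cfin : cost mu nu \is a fin_num by rewrite costw.
have [_ [g cg <-] lte] := lb_ereal_inf_adherent e0 cfin.
by exists g => //; rewrite EFinD -costw ltW.
Qed.

Lemma ball_brunn_minkowski (x0 : X) (r0 r1 s t c0 c1 c : R) :
  separable X -> CD0oo m -> (0 < t < 1)%R -> (r0 + t * (r0 + r1) < s)%R ->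
  (0 < c0)%R -> (0 < c1)%R -> (0 < c)%R -> m (ball x0 r0) = c0%:E ->
  m (ball x0 r1) = c1%:E -> m (ball x0 s) = c%:E ->
  ((1 - t) * ln c0 + t * ln c1 <= ln c)%R.
Proof.
move=> sepX cd t01 thr c00 c10 c_0 mB0 mB1 mBs; have /andP[t0 t1] := t01.
have mB r := measurable_borel_ball x0 r.
have [mu0 mu0E] := uniform_probability (mB r0) mB0 c00.
have [mu1 mu1E] := uniform_probability (mB r1) mB1 c10.
have mu0B : mu0 (~` ball x0 r0) = 0.
  by rewrite mu0E ?setICl ?measure0 ?mule0//; exact: (measurableC (mB r0)).
have mu1B : mu1 (~` ball x0 r1) = 0.
  by rewrite mu1E ?setICl ?measure0 ?mule0//; exact: (measurableC (mB r1)).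
have mom0 := second_moment_ball mu0B; have mom1 := second_moment_ball mu1B.
have [mu_ [_ same0 same1 geo] ent] := cd _ _ (ex_intro _ x0 mom0) (ex_intro _ x0 mom1).
have [w costw] : exists w, cost mu0 mu1 = w%:E.
  have := cost_lty sepX mom0 mom1; have := cost_ge0 mu0 mu1.
  by case: (cost mu0 mu1) => // w _ _; exists w.
have ti : (0 <= t <= 1)%R by rewrite !ltW.
have geo0 := geo 0%R t; have geo1 := geo t 1%R.
rewrite !lexx !ler01 subr0 (gtr0_norm t0) in geo0.
rewrite !lexx !ler01 gtr0_norm ?subr_gt0// in geo1.
have cost0 := cost_adherent (cost_W2 (ltW t0) costw (geo0 isT ti)).
have t10 : (0 <= 1 - t)%R by rewrite subr_ge0 ltW.
have cost1 := cost_adherent (cost_W2 t10 costw (geo1 ti isT)).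
have nuB : mu_ t (~` ball x0 s) = 0.
  apply: (@intermediate_concentration _ _ sepX mu0 mu1 _ t w r0 r1) => //.
  - by move=> g cg; rewrite -costw; apply: ereal_inf_lbound; exists g.
  (* The endpoints of the geodesic agree with the given measures on measurable sets, which is all
     that a coupling sees. *)
  - move=> e /cost0[g cg ge]; exists g => // A mA.
    by have [gA gB] := cg _ mA; rewrite -same0.
  - move=> e /cost1[g cg ge]; exists g => // A mA.
    by have [gA gB] := cg _ mA; rewrite -same1.
have := ent t ti; rewrite (Ent_uniform (mB r0) mB0 c00 mu0E).
rewrite (Ent_uniform (mB r1) mB1 c10 mu1E).
(* Jensen bounds the entropy at time [t] below by [- ln c], convexity bounds it above; both end
   entropies are finite, so the dual sum is the ordinary one. *)
have := Ent_ge (mB s) nuB mBs c_0 => /le_trans /[apply].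
rewrite -!EFinM -DualAddTheoryNumDomain.dEFinD lee_fin; lra.
Qed.

End brunn_minkowski.

(** * A Fekete-type limit *)

(** The limit is the infimum of [S]. A nearly optimal [s0] bounds [(f r - c) / r] from above for all
    large [r], while the element of [S] at [r] itself bounds it from below up to the factor
    [(r - 3) / r]. *)
Lemma cvg_growth_rate (R : realType) (f : R -> R) (c : R) :
  (forall r, 1 <= r -> c <= f r)%R ->
  (forall s r, 3 < s -> s - 3 < r -> (f r - c) / r <= (f s - c) / (s - 3))%R ->
  exists2 h : R, (0 <= h)%R & (f r / r)%R @[r --> +oo%R] --> h.
Proof.
move=> fc fmono.
pose S := [set (f s - c) / (s - 3) | s in [set s | 3 < s]]%R.
have S0 : lbound S 0%R.
  move=> _ [s /= s3 <-]; rewrite divr_ge0 ?subr_ge0// ?fc// ?ltW//.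
  by rewrite (le_lt_trans _ s3)// ler1n.
have Sinf : has_inf S.
  split; last by exists 0%R.
  by exists ((f 4 - c) / (4 - 3))%R; exists 4%R => //=; rewrite ltr_nat.
have infS0 : (0 <= inf S)%R by apply: lb_le_inf S0; case: Sinf.
exists (inf S) => //; apply/cvgrPdist_le => e e0.
have e20 : (0 < e / 2)%R by rewrite divr_gt0.
have [_ [s0 /= s03 <-] s0inf] := inf_adherent e20 Sinf.
(* Beyond [u] and [v], the errors [3 * inf S / r] and [c / r] are at most [e / 2] in absolute
   value. *)
pose u := (3 * inf S / (e / 2))%R; pose v := (`|c| / (e / 2))%R.
have u0 : (0 <= u)%R by apply: divr_ge0; [exact: mulr_ge0|exact: ltW].
have v0 : (0 <= v)%R by apply: divr_ge0 => //; exact: ltW.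
exists (s0 + u + v)%R; split; first exact: num_real.
move=> r Mr.
have [ur vr s0r] : [/\ u <= r, v <= r & s0 < r]%R.
  by clearbody u v; split; lra.
have r3 : (3 < r)%R by lra.
have r0 : (0 < r)%R by lra.
have b1 : (3 * inf S / r <= e / 2)%R.
  by rewrite ler_pdivrMr// [leRHS]mulrC -ler_pdivrMr.
have b2 : (`|c / r| <= e / 2)%R.
  rewrite normrM normfV (gtr0_norm r0) ler_pdivrMr// [leRHS]mulrC.
  by rewrite -ler_pdivrMr.
have up : ((f r - c) / r <= inf S + e / 2)%R.
  by apply: le_trans (fmono s0 r s03 _) (ltW s0inf); clear -s0r; lra.
have lo : (inf S - 3 * inf S / r <= (f r - c) / r)%R.
  rewrite (_ : inf S - _ = inf S * (r - 3) / r)%R; last by field; rewrite gt_eqF.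
  rewrite ler_pM2r ?invr_gt0// -ler_pdivlMr ?subr_gt0//.
  by apply: ge_inf; [exists 0%R|exists r].
have -> : (f r / r = (f r - c) / r + c / r)%R by field; rewrite gt_eqF.
move: b2; rewrite !ler_norml => /andP[b2 b3]; apply/andP; split; lra.
Qed.

(** * Existence of the volume entropy *)

Lemma ball_volume_mono (R : realType) (X : completeMetricType R)
    (m : {measure set (borel X) -> \bar R}) (x0 : X) (r s : R) :
  (r <= s)%R -> m (ball x0 r) <= m (ball x0 s).
Proof.
move=> rs; apply: le_measure; rewrite ?inE; [exact: measurable_borel_ball..|].
exact: le_ball.
Qed.

Theorem proposition2p2 (R : realType) (X : completeMetricType R)
    (m : {measure set (borel X) -> \bar R})
    (mms : metric_measure_space m) (cd : CD0oo m) :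
  exists x0 : X, exists2 h : \bar R, 0 <= h &
    lne (m (ball x0 r)) / r%:E @[r --> +oo%R] --> h.
Proof.
have [sepX _ supp] := mms; exists point; set x0 : X := point.
have [[r1 mr1]|fin] := pselect (exists r : R, m (ball x0 r) = +oo).
  exists +oo => //; apply: cvg_near_cst.
  exists (Num.max r1 0%R); split; first exact: num_real.
  move=> r; rewrite gt_max => /andP[r1r r0].
  have -> : m (ball x0 r) = +oo.
    by apply/eqP; rewrite -leye_eq -mr1 ball_volume_mono// ltW.
  by rewrite /= inver gt_eqF// gt0_mulye// lte_fin invr_gt0.
pose c r := fine (m (ball x0 r)).
have cE r : m (ball x0 r) = (c r)%:E.
  rewrite fineK// ge0_fin_numE// ltey; apply/eqP => mr; apply: fin.
  by exists r.
have c0 r : (0 < r)%R -> (0 < c r)%R.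
  by move=> r0; rewrite -lte_fin -cE; exact: measure_ball_gt0.
have [r r1|s r s3 sr|h h0 fh] := @cvg_growth_rate R (fun r => ln (c r)) (ln (c 1%R)).
- rewrite ler_ln ?posrE ?c0 ?(lt_le_trans ltr01)//.
  by rewrite -lee_fin -!cE ball_volume_mono.
- have r0 : (0 < r)%R by lra.
  (* With radii [1] and [r] the threshold is [1 + t * (1 + r) = s - 2 + t], which is below [s]
     because [t < 1]. *)
  pose t := ((s - 3) / r)%R.
  have t0 : (0 < t)%R by rewrite divr_gt0// subr_gt0.
  have t1 : (t < 1)%R by rewrite ltr_pdivrMr// mul1r.
  have tr : (t * r = s - 3)%R by rewrite divfK// gt_eqF.
  have := @ball_brunn_minkowski _ _ m x0 1 r s t (c 1%R) (c r) (c s) sepX cd.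
  rewrite t0 t1 !c0//; last lra.
  move=> /(_ isT _ isT isT isT (cE _) (cE _) (cE _))/wrap[|bm]; first lra.
  rewrite ler_pdivlMr ?subr_gt0// mulrAC -mulrA -/t mulrC; lra.
exists h%:E; first by rewrite lee_fin.
have lnE r : (0 < r)%R -> lne (m (ball x0 r)) / r%:E = (ln (c r) / r)%:E.
  by move=> r0; rewrite cE lne_EFin ?c0// inver gt_eqF// -EFinM.
apply: cvg_EFin.
  by exists 0%R; split; [exact: num_real|move=> r r0; rewrite lnE].
apply: cvg_trans fh; apply: near_eq_cvg.
by exists 0%R; split; [exact: num_real|move=> r r0; rewrite /= lnE].
Qed.
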